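(* Let $t\geqslant5$ be odd and let $(y_n)_{n=t}^\infty$ be the normal form orbit of order $t$. Then $$y_t=\frac t2,\qquad y_{t+1}=\frac t2+1,\qquad y_{t+2}=\frac{t^2}{4},\qquad y_{t+3}=\frac{t^2}{4}+\frac t2-1,$$ with $$0<1<y_t<y_{t+1}<y_{t+2}<y_{t+3}.$$ Moreover, for every $\ell\in\mathbb{N}$ (positive integers), if $t>u_\ell:=\ell+1+\sqrt{5\ell^2+6\ell+5}$ then $$y_{t+4\ell}=\frac{\ell+1}{2}t+\ell^2+\ell,\qquad y_{t+4\ell+1}=\frac{\ell+1}{2}t+\ell^2+\ell+1,$$ $$y_{t+4\ell+2}=\frac{t^2}{4}+\frac52\ell t+5\ell^2-\ell,\qquad y_{t+4\ell+3}=\frac{t^2}{4}+\frac{5\ell+1}{2}t+5\ell^2+\ell-1,$$ with $$y_{t+4\ell-3}<y_{t+4\ell}<y_{t+4\ell+1}<y_{t+2}\qquad\text{and}\qquad y_{t+4\ell-1}<y_{t+4\ell+2}<y_{t+4\ell+3}.$$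
   Context: Normal form orbit of order $t$ ($t\geqslant5$ odd): set $\gamma_{t-1}:=[0,1]$, $\mathcal{M}_{t-2}:=0$, $\mathcal{M}_{t-1}:=\frac12$, and for every $n\geqslant t$ let $y_n=n\mathcal{M}_{n-1}-(n-1)\mathcal{M}_{n-2}$, $\gamma_n=\gamma_{n-1}\uplus[y_n]$ (multiset union), and $\mathcal{M}_n:=\mathcal{M}(\gamma_n)$, the median of the multiset $\gamma_n$ (the average of the two central elements if $|\gamma_n|$ is even). *)

(* Defs.v *)
From mathcomp Require Import all_boot all_order all_algebra.
From mathcomp Require Import finmap multiset.

Set Implicit Arguments.
Unset Strict Implicit.
Unset Printing Implicit Defensive.

Import Order.TTheory GRing.Theory Num.Theory.
Local Open Scope ring_scope.
Local Open Scope mset_scope.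

(* On the empty multiset this returns the junk value 0. *)
Definition median (R : realFieldType) (A : {mset R}) : R :=
  let s := sort <=%R (enum_mset A) in
  let m := (size s)./2 in
  if odd (size s) then s`_m else (s`_m.-1 + s`_m) / 2.

(* Only the values y n for t <= n, gamma n for t - 1 <= n and M n for
   t - 2 <= n are constrained; the union of multisets is additive. *)
Record normal_form_orbit (R : realFieldType) (t : nat)
    (gamma : nat -> {mset R}) (M : nat -> R) (y : nat -> R) : Prop :=
  NormalFormOrbit {
    nfo_gamma_init : gamma (t - 1)%N = [mset 0; 1];
    nfo_M_init2 : M (t - 2)%N = 0;
    nfo_M_init1 : M (t - 1)%N = 1 / 2;
    nfo_y : forall n : nat, (t <= n)%N ->
      y n = n%:R * M (n - 1)%N - (n - 1)%:R * M (n - 2)%N;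
    nfo_gamma : forall n : nat, (t <= n)%N ->
      gamma n = gamma (n - 1)%N `+` [mset y n];
    nfo_M : forall n : nat, (t <= n)%N -> M n = median (gamma n)
  }.

Lemma normal_form_orbit_exists (R : realFieldType) (t : nat) :
  (2 <= t)%N ->
  exists gamma : nat -> {mset R}, exists M : nat -> R, exists y : nat -> R,
    normal_form_orbit t gamma M y.
Proof.
move=> t2.
(* state after k steps: (gamma_{t-1+k}, M_{t-2+k}, M_{t-1+k}) *)
pose ynext (k : nat) (st : {mset R} * R * R) : R :=
  (t + k)%:R * st.2 - (t + k - 1)%:R * st.1.2.
pose fix st (k : nat) : {mset R} * R * R :=
  if k is k'.+1 then
    let g := (st k').1.1 `+` [mset ynext k' (st k')] in
    (g, (st k').2, median g)
  else ([mset 0; 1], 0, 1 / 2).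
have st2 k : (st k.+1).1.2 = (st k).2 by [].
exists (fun n => (st (n.+1 - t)%N).1.1).
exists (fun n => (st (n.+2 - t)%N).1.2).
exists (fun n => ynext (n - t)%N (st (n - t)%N)).
have shift n : (t <= n)%N ->
  [/\ (n - 1).+1 = n, (n - 1).+2 = n.+1, (n - 2).+2 = n,
      (n.+1 - t = (n - t).+1)%N & (n.+2 - t = (n - t).+2)%N].
  move=> tn; have n2 := leq_trans t2 tn.
  have n1 : (n - 1).+1 = n by rewrite -subSn ?subn1 // ltnW.
  by split; rewrite ?n1 //; [rewrite -!subSn // ?subSS ?subn0 // ltnW
    | rewrite subSn | rewrite !subSn // leqW].
have [t1 t12 t22 tS _] := shift t (leqnn t).
split; rewrite ?t1 ?t12 ?t22 ?tS ?subnn //.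
- by move=> n tn; have [_ -> -> -> _] := shift n tn; rewrite /ynext subnKC.
- by move=> n tn; have [-> _ _ -> _] := shift n tn.
- by move=> n tn; have [_ _ _ -> ->] := shift n tn.
Qed.

(* Main.v *)
Require Import Defs.
From mathcomp Require Import all_boot all_order all_algebra.
From mathcomp Require Import finmap multiset.
From mathcomp Require Import zify ring lra.

(** The orbit moves in blocks of four steps.  Call the orbit centred at [p] at
    time [m] when [M m = p], [M (m + 1) = p + 1/2], and the multiset at time
    [m + 1] has [p] and [p + 1] as its two central elements.  With
    [n = m + 2], the next four elements are then forced, provided that the first
    two of them stay below all the elements to the right of [p + 1]:

      [p + n/2],  [p + n/2 + 1],  [p + n^2/4],  [p + n^2/4 + n/2 - 1].

    The first two land between [p + 1] and the elements to its right, and the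
    last two land to the right of the first two.  Adding four elements above
    the two central ones shifts the centre by two places, onto the first two
    new elements, which again differ by 1: the orbit is centred at [p + n/2]
    at time [m + 4].  This is [centred_step].

    The initial data [M (t - 2) = 0], [M (t - 1) = 1/2], [{0, 1}] say that the
    orbit is centred at 0 at time [t - 2], so the case [l = 0] of the formulas
    is the same computation as the others.  Summing the increments
    [(t + 4 j) / 2] for [j < k] gives the successive centres
    [centre t k = k t / 2 + k^2 - k].  All far elements are at least
    [T = t^2 / 4], the first of them, so the block [k = l] goes through
    when its two low elements stay below [T], which follows from
    [centre t (l + 1) + 1 < t^2 / 4].  This inequality is quadratic in [t] and
    its positive root is [l + 1 + sqrt (5 l^2 + 6 l + 5)].  As the centres
    increase with [l], it implies the same inequality for all earlier
    blocks. *)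

Import Order.TTheory GRing.Theory Num.Theory.
Local Open Scope ring_scope.

(** * Medians from a splitting around the centre *)

Section Median.
Variable R : realFieldType.
Implicit Types (A : {mset R}%mset) (x z : R) (a b : seq R).

(** Sorting only the two outer parts already gives a sorted list, and a
    multiset has only one sorted enumeration. *)
Lemma sort_split (s a b c : seq R) :
  perm_eq s (a ++ c ++ b) -> sorted <=%R c ->
  allrel <=%R a (c ++ b) -> allrel <=%R c b ->
  sort <=%R s = sort <=%R a ++ c ++ sort <=%R b.
Proof.
move=> s_acb c_sorted a_le c_le.
apply: (sorted_eq le_trans le_anti); first exact: sort_le_sorted.
- rewrite le_sorted_pairwise !pairwise_cat -!le_sorted_pairwise.
  rewrite c_sorted !sort_le_sorted !andbT /=; apply/andP; split.
    rewrite -(eq_allrel_memr _ _ (s2 := c ++ b)); last first.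
      by move=> u; rewrite !mem_cat mem_sort.
    by rewrite -(eq_allrel_meml _ _ (s1 := a)) // => u; rewrite mem_sort.
  by rewrite -(eq_allrel_memr _ _ (s2 := b)) // => u; rewrite mem_sort.
- rewrite perm_sort (perm_trans s_acb) //; apply: perm_cat.
    by rewrite perm_sym perm_sort.
  by rewrite perm_cat2l perm_sym perm_sort.
Qed.

Lemma median_odd A a b x :
  perm_eq (enum_mset A) (a ++ x :: b) -> size a = size b ->
  all (<= x) a -> all (>= x) b -> median A = x.
Proof.
move=> A_axb size_ab a_le b_ge.
have sizeA : size (sort <=%R (enum_mset A)) = (size b).*2.+1.
  by rewrite size_sort (perm_size A_axb) size_cat /= size_ab addnS addnn.
have := sort_split _ a b [:: x] A_axb isT.
rewrite /median /= sizeA /= uphalf_double odd_double /= => ->.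
- by rewrite nth_cat size_sort size_ab ltnn subnn.
- apply/allrelP => u v ua; rewrite in_cons => /predU1P[-> | vb].
    exact: (allP a_le).
  exact: le_trans (allP a_le u ua) (allP b_ge v vb).
- by rewrite allrel1l.
Qed.

Lemma median_even A a b x z :
  perm_eq (enum_mset A) (a ++ [:: x, z & b]) -> size a = size b -> x <= z ->
  all (<= x) a -> all (>= z) b -> median A = (x + z) / 2.
Proof.
move=> A_axzb size_ab x_le_z a_le b_ge.
have sizeA : size (sort <=%R (enum_mset A)) = (size b).*2.+2.
  rewrite size_sort (perm_size A_axzb) size_cat /= size_ab.
  by rewrite !addnS addnn.
have := sort_split _ a b [:: x; z] A_axzb.
rewrite /median /= sizeA /= doubleK odd_double /= x_le_z => -> //.
- by rewrite !nth_cat size_sort size_ab ltnn subnn ltnNge leqnSn subSnn.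
- apply/allrelP => u v ua; have ux := allP a_le u ua.
  rewrite !in_cons => /or3P[/eqP-> // | /eqP-> | vb].
    exact: le_trans ux x_le_z.
  exact: le_trans ux (le_trans x_le_z (allP b_ge v vb)).
- rewrite allrel_consl allrel1l; apply/andP; split=> //.
  by apply: sub_all b_ge => v; apply: le_trans.
Qed.

Lemma perm_enum_msetD1 A x :
  perm_eq (enum_mset (A `+` [mset x])%mset) (x :: enum_mset A).
Proof.
apply/allP => u _ /=.
by rewrite !count_mem_mset msetE2 msetnE addnC [u == x]eq_sym; case: (x == u).
Qed.

End Median.

(** * One block of four steps *)

Section Block.
Variables (R : realFieldType) (t : nat).
Variables (gamma : nat -> {mset R}%mset) (M y : nat -> R).
Hypothesis orbit : normal_form_orbit t gamma M y.

(** The lower bound [T] on the elements to the right of the centre is all that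
    has to be remembered of the far elements. *)
Definition centred (T : R) (m : nat) (p : R) : Prop :=
  [/\ M m = p, M m.+1 = p + 1 / 2
    & exists a b : seq R,
      [/\ perm_eq (enum_mset (gamma m.+1)) (a ++ [:: p, p + 1 & b]),
          size a = size b, all (<= p) a & all (>= T) b]].

Lemma orbit_y (m : nat) : (t <= m.+2)%N ->
  y m.+2 = (m%:R + 2) * M m.+1 - (m%:R + 1) * M m.
Proof.
move=> tm; rewrite (nfo_y orbit) // !subSS !subn0 -!natr1; ring.
Qed.

Lemma orbit_count (m : nat) (P : pred R) : (t <= m.+2)%N ->
  count P (enum_mset (gamma m.+2)) =
    (P (y m.+2) + count P (enum_mset (gamma m.+1)))%N.
Proof.
move=> tm; rewrite (nfo_gamma orbit) // subSS subn0.
exact: (permP (perm_enum_msetD1 _ _ _)).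
Qed.

(** Every new median is read off from its position: the four new elements lie
    above [p + 1], so the centre moves up by half a place at each step. *)
Lemma centred_step (T p : R) (m : nat) :
  (t <= m.+2)%N -> centred T m p ->
  let n : R := m%:R + 2 in
  2 <= n -> p + n / 2 + 1 <= T -> T <= p + n ^+ 2 / 4 ->
  [/\ y m.+2 = p + n / 2,
      y m.+3 = p + n / 2 + 1,
      y m.+4 = p + n ^+ 2 / 4,
      y m.+4.+1 = p + n ^+ 2 / 4 + n / 2 - 1
    & centred T m.+4 (p + n / 2)].
Proof.
move=> tm [Mm Mm1 [a [b [gamma_m1 size_ab a_le b_ge]]]] n n2 low_le_T T_le.
have [tm3 tm4 tm5] : [/\ t <= m.+3, t <= m.+4 & t <= m.+4.+1]%N by split; lia.
have a_le_ge q : p <= q -> all (<= q) a.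
  by move=> pq; apply: sub_all a_le => u /le_trans; apply.
have b_ge_le q : q <= T -> all (>= q) b.
  by move=> qT; apply: sub_all b_ge => u; apply: le_trans.
have y2 : y m.+2 = p + n / 2 by rewrite orbit_y // Mm Mm1 /n; field.
have M2 : M m.+2 = p + 1.
  rewrite (nfo_M orbit) //.
  apply: (@median_odd _ _ (p :: a) (y m.+2 :: b)) => /=.
  - apply/permP => P; rewrite orbit_count // (permP gamma_m1) /= !count_cat /=.
    lia.
  - by rewrite size_ab.
  - by rewrite a_le_ge; lra.
  - by rewrite y2 b_ge_le; lra.
have y3 : y m.+3 = p + n / 2 + 1.
  by rewrite orbit_y // M2 Mm1 -natr1 /n; field.
have M3 : M m.+3 = (p + 1 + (p + n / 2)) / 2.
  rewrite (nfo_M orbit) //.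
  apply: (@median_even _ _ (p :: a) (y m.+3 :: b)) => /=.
  - apply/permP => P; rewrite !orbit_count // (permP gamma_m1) y2.
    rewrite /= !count_cat /=; lia.
  - by rewrite size_ab.
  - lra.
  - by rewrite a_le_ge; lra.
  - by rewrite y3 b_ge_le; lra.
have y4 : y m.+4 = p + n ^+ 2 / 4.
  by rewrite orbit_y // M3 M2 -!natr1 /n; field.
have M4 : M m.+4 = p + n / 2.
  rewrite (nfo_M orbit) //.
  apply: (@median_odd _ _ [:: p, p + 1 & a] [:: y m.+3, y m.+4 & b]) => /=.
  - apply/permP => P; rewrite !orbit_count // (permP gamma_m1) y2.
    rewrite /= !count_cat /=; lia.
  - by rewrite size_ab.
  - by rewrite a_le_ge; lra.
  - by rewrite y3 y4 b_ge_le; lra.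
have y5 : y m.+4.+1 = p + n ^+ 2 / 4 + n / 2 - 1.
  by rewrite orbit_y // M4 M3 -!natr1 /n; field.
have gamma_m5 : perm_eq (enum_mset (gamma m.+4.+1))
    ([:: p, p + 1 & a] ++
      [:: p + n / 2, p + n / 2 + 1, y m.+4, y m.+4.+1 & b]).
  apply/permP => P; rewrite !orbit_count // (permP gamma_m1) -y3 -y2.
  rewrite /= !count_cat /=; lia.
have far_ge : all (>= T) [:: y m.+4, y m.+4.+1 & b].
  by rewrite /= y4 y5 b_ge; lra.
split=> //; split=> //.
- rewrite (nfo_M orbit) //.
  rewrite (median_even _ _ _ _ _ _ gamma_m5) //=; first by field.
  + by rewrite size_ab.
  + lra.
  + by rewrite a_le_ge; lra.
  + by rewrite y4 y5 b_ge_le; lra.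
- exists [:: p, p + 1 & a], [:: y m.+4, y m.+4.+1 & b]; split=> //=.
  + by rewrite size_ab.
  + by rewrite a_le_ge; lra.
Qed.

End Block.

Arguments centred {R} gamma M T m p.

(** * The successive centres *)

Definition centre {R : realFieldType} (t k : nat) : R :=
  k%:R / 2 * t%:R + k%:R ^+ 2 - k%:R.

Section Centres.
Variables (R : realFieldType) (t : nat).
Hypothesis t_ge5 : (5 <= t)%N.
Variables (gamma : nat -> {mset R}%mset) (M y : nat -> R).
Hypothesis orbit : normal_form_orbit t gamma M y.
Local Notation T := (t%:R ^+ 2 / 4 : R).

Lemma tR_ge5 : 5 <= t%:R :> R. Proof. by rewrite ler_nat. Qed.

Lemma centreS (k : nat) :
  centre t k.+1 = centre t k + (t%:R + 4 * k%:R) / 2 :> R.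
Proof. by rewrite /centre -natr1; field. Qed.

Lemma centre_ge0 (k : nat) : 0 <= centre t k :> R.
Proof.
elim: k => [|k IHk]; first by rewrite /centre; lra.
by rewrite centreS; have := tR_ge5; have := ler0n R k; lra.
Qed.

Lemma orbit_block (k : nat) :
  centred gamma M T (t - 2 + 4 * k) (centre t k) ->
  centre t k.+1 + 1 <= T ->
  let n : R := t%:R + 4 * k%:R in
  [/\ y (t + 4 * k)%N = centre t k.+1,
      y (t + 4 * k + 1)%N = centre t k.+1 + 1,
      y (t + 4 * k + 2)%N = centre t k + n ^+ 2 / 4,
      y (t + 4 * k + 3)%N = centre t k + n ^+ 2 / 4 + n / 2 - 1
    & centred gamma M T (t - 2 + 4 * k.+1) (centre t k.+1)].
Proof.
move=> ck low n; have tR := tR_ge5; have k0 := ler0n R k.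
have nE : n = (t - 2 + 4 * k)%:R + 2.
  by rewrite natrD natrM natrB ?(ltn_trans _ t_ge5) // /n; ring.
have tE : (t + 4 * k = (t - 2 + 4 * k).+2)%N by lia.
have mE : (t - 2 + 4 * k.+1 = (t - 2 + 4 * k).+4)%N by lia.
have far : T <= centre t k + n ^+ 2 / 4.
  by have := centre_ge0 k; rewrite /n; nra.
rewrite centreS -/n in low *.
rewrite mE !tE !addn1 !addn2 !addn3.
have tm : (t <= (t - 2 + 4 * k).+2)%N by lia.
have := centred_step _ _ _ _ _ orbit _ _ _ tm ck.
by rewrite /= -nE; apply=> //; rewrite /n; lra.
Qed.

(** The increments of the centre are positive, so a bound on the last centre
    bounds all the earlier ones. *)
Lemma orbit_centred (k : nat) :
  centre t k + 1 <= T -> centred gamma M T (t - 2 + 4 * k) (centre t k).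
Proof.
elim: k => [_ | k IHk low]; last first.
  have low_k : centre t k + 1 <= T.
    by move: low; rewrite centreS; have := tR_ge5; have := ler0n R k; lra.
  by have [] := orbit_block k (IHk low_k) low.
have c0 : centre t 0 = 0 :> R by rewrite /centre; ring.
have t1 : (t - 2).+1 = (t - 1)%N by lia.
rewrite muln0 addn0 c0; split; rewrite ?t1.
- exact: nfo_M_init2 orbit.
- by rewrite (nfo_M_init1 orbit) add0r.
- exists [::], [::]; split=> //=.
  rewrite (nfo_gamma_init orbit) add0r; apply/allP => u _ /=.
  by rewrite count_mem_mset mset1DE msetnE ![u == _]eq_sym addn0; do 2![case: (_ == u)].
Qed.

End Centres.

(** [u_l] is the positive root in [t] of
    [t^2 - 2 (l + 1) t - 4 (l^2 + l + 1)], which is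
    [4 (T - centre t (l + 1) - 1)] for [T = t^2 / 4]. *)
Lemma centre_lt (R : rcfType) (t l : nat) :
  l%:R + 1 + Num.sqrt (5 * l%:R ^+ 2 + 6 * l%:R + 5) < t%:R :> R ->
  centre t l.+1 + 1 < t%:R ^+ 2 / 4 :> R.
Proof.
set c := (X in Num.sqrt X) => ul.
have c_ge0 : 0 <= c by rewrite /c; have := ler0n R l; nra.
have := sqr_sqrtr c_ge0; have := sqrtr_ge0 c; move: (Num.sqrt c) ul => r ul r0.
rewrite /centre -natr1 /c => rE.
have : r ^+ 2 < (t%:R - l%:R - 1) ^+ 2 by nra.
by rewrite rE; lra.
Qed.

Theorem lemma18 (R : rcfType) (t : nat) (ht5 : (5 <= t)%N) (htodd : odd t)
    (gamma : nat -> {mset R}%mset) (M : nat -> R) (y : nat -> R)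
    (hy : normal_form_orbit t gamma M y) :
  [/\ y t = t%:R / 2,
      y (t + 1)%N = t%:R / 2 + 1,
      y (t + 2)%N = t%:R ^+ 2 / 4
    & y (t + 3)%N = t%:R ^+ 2 / 4 + t%:R / 2 - 1]
  /\ [/\ (0 : R) < 1, 1 < y t, y t < y (t + 1)%N,
         y (t + 1)%N < y (t + 2)%N & y (t + 2)%N < y (t + 3)%N]
  /\ (forall l : nat, (0 < l)%N ->
        l%:R + 1 + Num.sqrt (5 * l%:R ^+ 2 + 6 * l%:R + 5) < t%:R :> R ->
        [/\ y (t + 4 * l)%N = (l%:R + 1) / 2 * t%:R + l%:R ^+ 2 + l%:R,
            y (t + 4 * l + 1)%N =
              (l%:R + 1) / 2 * t%:R + l%:R ^+ 2 + l%:R + 1,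
            y (t + 4 * l + 2)%N =
              t%:R ^+ 2 / 4 + 5 / 2 * l%:R * t%:R + 5 * l%:R ^+ 2 - l%:R
          & y (t + 4 * l + 3)%N =
              t%:R ^+ 2 / 4 + (5 * l%:R + 1) / 2 * t%:R
                + 5 * l%:R ^+ 2 + l%:R - 1]
        /\ [/\ y (t + 4 * l - 3)%N < y (t + 4 * l)%N,
               y (t + 4 * l)%N < y (t + 4 * l + 1)%N
             & y (t + 4 * l + 1)%N < y (t + 2)%N]
        /\ [/\ y (t + 4 * l - 1)%N < y (t + 4 * l + 2)%N
             & y (t + 4 * l + 2)%N < y (t + 4 * l + 3)%N]).
Proof.
have tR := tR_ge5 R t ht5.
have block k : centre t k.+1 + 1 <= t%:R ^+ 2 / 4 :> R ->
    let n : R := t%:R + 4 * k%:R in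
    [/\ y (t + 4 * k)%N = centre t k.+1,
        y (t + 4 * k + 1)%N = centre t k.+1 + 1,
        y (t + 4 * k + 2)%N = centre t k + n ^+ 2 / 4
      & y (t + 4 * k + 3)%N = centre t k + n ^+ 2 / 4 + n / 2 - 1].
  move=> low n.
  have low_k : centre t k + 1 <= t%:R ^+ 2 / 4 :> R.
    by move: low; rewrite centreS; have := ler0n R k; lra.
  have ck := orbit_centred _ _ ht5 _ _ _ hy k low_k.
  by have [] := orbit_block _ _ ht5 _ _ _ hy k ck low.
have low0 : centre t 1 + 1 <= t%:R ^+ 2 / 4 :> R by rewrite /centre; nra.
have [] := block 0%N low0; rewrite /= muln0 addn0 /centre => y0 y1 y2 y3.
split; first by split; rewrite ?y0 ?y1 ?y2 ?y3; field.
split; first by rewrite y0 y1 y2 y3; split; nra.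
case=> // l _ /centre_lt low.
have l0 := ler0n R l.
have [z0 z1 z2 z3] := block _ (ltW low).
have low_l : centre t l.+1 + 1 <= t%:R ^+ 2 / 4 :> R.
  by move: low; rewrite centreS -natr1; lra.
have [_ x1 _ x3] := block _ low_l.
have -> : (t + 4 * l.+1 - 3 = t + 4 * l + 1)%N by lia.
have -> : (t + 4 * l.+1 - 1 = t + 4 * l + 3)%N by lia.
rewrite x1 x3 z0 z1 z2 z3 y2; move: low; rewrite /centre -[l.+2%:R]natr1 -[l.+1%:R]natr1 => low.
split; first by split; field.
by split; split; lra.
Qed.
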